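(* Let $x:I\subset\mathbb{R}\to\mathbb{E}^3$ be a unit speed twisted curve in $\mathbb{E}^3$. If $x$ is of constant-ratio, then the position vector of the curve has the form $$x(s)=(c^2s+cb)\,T(s)+\left(\frac{c^2-1}{\kappa_1}\right)N_1(s)+\left(\frac{\kappa_1(c^2s+cb)}{\kappa_2}-\frac{(c^2-1)\kappa_1'}{\kappa_2\kappa_1^2}\right)N_2(s)$$ for some constants $b\in\mathbb{R}$, $c\in[0,1)$.
   Context: For a unit speed curve $x(s)$ in Euclidean 3-space $\mathbb{E}^3$, the Frenet frame $T=x'$, $N_1$, $N_2=T\times N_1$ and curvature $\kappa_1=\|x''\|>0$, torsion $\kappa_2$ satisfy $T'=\kappa_1N_1$, $N_1'=-\kappa_1T+\kappa_2N_2$, $N_2'=-\kappa_2N_1$. A curve is twisted if $\kappa_1$ and $\kappa_2$ are nowhere zero. The position vector (also denoted $x$) decomposes as $x=x^T+x^N$ into its components tangential and normal to the curve. The curve is of constant-ratio if the ratio $\|x^T\|:\|x^N\|$ is constant along the curve, or equivalently $\|x^T\|:\|x\|=c$ is constant. *)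

(* Defs.v *)
From mathcomp Require Import all_boot all_order all_algebra.
From mathcomp Require Import all_classical all_reals all_analysis.

Set Implicit Arguments.
Unset Strict Implicit.
Unset Printing Implicit Defensive.

Import Order.TTheory GRing.Theory Num.Theory.
Import numFieldNormedType.Exports.

Local Open Scope classical_set_scope.
Local Open Scope ring_scope.

(* The library norm on ['rV[R]_3] is the max norm: it is used only for the
   topology (limits and derivatives); lengths are taken with [enorm]. *)
Definition dot (R : realType) (u v : 'rV[R]_3) : R := (u *m v^T) 0 0.

Definition enorm (R : realType) (u : 'rV[R]_3) : R := Num.sqrt (dot u u).

(* [inord k] is the index k in {0, 1, 2}. *)
Definition cross (R : realType) (u v : 'rV[R]_3) : 'rV[R]_3 :=
  let e (w : 'rV[R]_3) (k : nat) : R := w 0 (inord k) in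
  \row_(j < 3)
    if j == 0%N :> nat then e u 1%N * e v 2%N - e u 2%N * e v 1%N
    else if j == 1%N :> nat then e u 2%N * e v 0%N - e u 0%N * e v 2%N
    else e u 0%N * e v 1%N - e u 1%N * e v 0%N.

Section Frenet.
Variables (R : realType) (x : R -> 'rV[R]_3).

Definition tangent (s : R) : 'rV[R]_3 := derive1 x s.

Definition curvature (s : R) : R := enorm (derive1n 2 x s).

Definition normal1 (s : R) : 'rV[R]_3 := (curvature s)^-1 *: derive1n 2 x s.

Definition normal2 (s : R) : 'rV[R]_3 := cross (tangent s) (normal1 s).

(* The N2-component of N1', i.e. the k2 of N1' = - k1 T + k2 N2. *)
Definition torsion (s : R) : R := dot (derive1 normal1 s) (normal2 s).

Definition tangential_part (s : R) : 'rV[R]_3 :=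
  dot (x s) (tangent s) *: tangent s.

Definition normal_part (s : R) : 'rV[R]_3 := x s - tangential_part s.

End Frenet.

(* A curve on [I] is given by a total function on the line.  No openness is
   required: at an endpoint belonging to [I], the derivatives are those of the
   extension of the curve provided by the total function. *)
Definition nondegenerate_interval (R : realType) (I : set R) : Prop :=
  is_interval I /\ exists s t : R, [/\ I s, I t & s < t].

(* Three derivatives are what is needed for the torsion to make sense. *)
Definition three_times_derivable (R : realType) (I : set R)
    (x : R -> 'rV[R]_3) : Prop :=
  forall (k : nat) (s : R), (k < 3)%N -> I s -> derivable (derive1n k x) s 1.

Definition unit_speed (R : realType) (I : set R) (x : R -> 'rV[R]_3) : Prop :=
  forall s : R, I s -> enorm (tangent x s) = 1.

Definition twisted (R : realType) (I : set R) (x : R -> 'rV[R]_3) : Prop :=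
  forall s : R, I s -> curvature x s != 0 /\ torsion x s != 0.

(* |x^T(s)| : |x^N(s)| = |x^T(t)| : |x^N(t)| for all s and t, as an equality of
   proportions, so that |x^N| = 0 is allowed (infinite ratio). *)
Definition constant_ratio (R : realType) (I : set R)
    (x : R -> 'rV[R]_3) : Prop :=
  forall s t : R, I s -> I t ->
    enorm (tangential_part x s) * enorm (normal_part x t) =
    enorm (tangential_part x t) * enorm (normal_part x s).

(* Main.v *)
Require Import Defs.
From mathcomp Require Import all_boot all_order all_algebra ring lra.
From mathcomp Require Import all_classical all_reals all_analysis.

Set Implicit Arguments.
Unset Strict Implicit.
Unset Printing Implicit Defensive.

Import Order.TTheory GRing.Theory Num.Theory.
Import numFieldNormedType.Exports.

Local Open Scope classical_set_scope.
Local Open Scope ring_scope.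

(** The formula is the expansion of the position vector in the Frenet frame,
    so everything rests on its three coordinates.

    Write [A = <x, T>].  Constancy of the ratio gives [A ^ 2 = c ^ 2 |x| ^ 2]
    with [0 <= c < 1]; the value [c = 1] would mean that [x] is always
    tangential, which the positive curvature excludes
    ([constant_ratio_tangential_coord]).  Differentiating, with [x' = T], yields
    [A (A' - c ^ 2) = 0].  If [c <> 0] then [A] has no zero: at a zero [x]
    vanishes, hence [A' = 1 + <x, x''> = 1], while differentiating the product
    once more gives [A' (A' - c ^ 2) = 0], that is [c = 1].  So [A' = c ^ 2] in
    all cases ([derive_tangential_coord]) and [A] is affine of slope [c ^ 2],
    which is the [T]-coordinate.

    Since [A' = 1 + k1 <x, N1>], the [N1]-coordinate is [(c ^ 2 - 1) / k1].
    Differentiating it with the Frenet equation [N1' = - k1 T + k2 N2]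
    ([derive_normal1E]) produces [- k1 A + k2 <x, N2>], from which the
    [N2]-coordinate is solved for.

    The interval may contain its endpoints, where derivatives are two-sided
    although the hypotheses speak of the interval only.  Every differentiation
    of an identity therefore goes through [is_derive_eq_on_interval]. *)

(** * Dot product and orthonormal expansions *)

Section Dot.
Variable R : realType.
Implicit Types (u v w : 'rV[R]_3) (a : R).

Lemma dotE u v : dot u v = \sum_i u 0 i * v 0 i.
Proof. by rewrite /dot mxE; apply: eq_bigr => i _; rewrite mxE. Qed.

Lemma dotC u v : dot u v = dot v u.
Proof. by rewrite !dotE; apply: eq_bigr => i _; rewrite mulrC. Qed.

Lemma dotDr u v w : dot u (v + w) = dot u v + dot u w.
Proof. by rewrite /dot linearD mulmxDr mxE. Qed.

Lemma dotZr a u v : dot u (a *: v) = a * dot u v.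
Proof. by rewrite /dot linearZ -scalemxAr mxE. Qed.

Lemma dotBl u v w : dot (u - v) w = dot u w - dot v w.
Proof. by rewrite /dot mulmxBl !mxE. Qed.

Lemma dotZl a u v : dot (a *: u) v = a * dot u v.
Proof. by rewrite dotC dotZr dotC. Qed.

Lemma dot_ge0 u : 0 <= dot u u.
Proof. by rewrite dotE sumr_ge0// => i _; rewrite -expr2 sqr_ge0. Qed.

Lemma dot_eq0 u : dot u u = 0 -> u = 0.
Proof.
rewrite dotE => /psumr_eq0P u0; apply/rowP => i; rewrite mxE.
by apply/eqP; rewrite -sqrf_eq0 expr2 u0// => j _; rewrite -expr2 sqr_ge0.
Qed.

Lemma enorm_sqr u : enorm u ^+ 2 = dot u u.
Proof. by rewrite sqr_sqrtr ?dot_ge0. Qed.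

Lemma ord3_coord (i : 'I_3) : [\/ i = inord 0, i = inord 1 | i = inord 2].
Proof.
by case: i => -[|[|[|//]]] ?; [apply: Or31|apply: Or32|apply: Or33];
  apply/val_inj; rewrite /= inordK.
Qed.

Lemma dot3E u v : dot u v = u 0 (inord 0) * v 0 (inord 0)
  + u 0 (inord 1) * v 0 (inord 1) + u 0 (inord 2) * v 0 (inord 2).
Proof.
rewrite dotE !big_ord_recl big_ord0 addr0 addrA.
by congr (_ + _ + _); congr (u 0 _ * v 0 _); apply/val_inj; rewrite /= inordK.
Qed.

(** An identity between polynomials in the coordinates, so that the expansion in
    an orthonormal pair and its cross product needs no basis argument. *)
Lemma gram_expansion u v w :
  (dot u u * dot v v - dot u v ^+ 2) *: w =
    (dot w u * dot v v - dot w v * dot u v) *: u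
    + (dot w v * dot u u - dot w u * dot u v) *: v
    + dot w (cross u v) *: cross u v.
Proof.
apply/rowP => i.
by rewrite !dot3E; case: (ord3_coord i) => ->; rewrite !mxE !inordK//=; ring.
Qed.

Lemma orthonormal_expansion u v w :
  dot u u = 1 -> dot v v = 1 -> dot u v = 0 ->
  w = dot w u *: u + dot w v *: v + dot w (cross u v) *: cross u v.
Proof.
move=> uu vv uv; have := gram_expansion u v w.
by rewrite uu vv uv expr0n !mulr0 !mulr1 !subr0 scale1r.
Qed.
End Dot.

(** * Derivatives of curves and of functions on an interval *)

Section Derivatives.
Variable R : realType.
Implicit Types (u v : R -> 'rV[R]_3) (f g : R -> R) (I : set R) (s : R).

Lemma is_derive_rVP u s (du : 'rV[R]_3) :
  is_derive s 1 u du <-> forall i, is_derive s 1 (fun t => u t 0 i) (du 0 i).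
Proof.
split=> [[du_s <-] i|du_s].
  have /derivable_mxP du_s' := du_s.
  by split=> //; rewrite derive_mx// mxE.
have du_s' : derivable u s 1.
  by apply/derivable_mxP => k i; rewrite ord1; case: (du_s i).
split=> //; rewrite derive_mx//; apply/rowP => i; rewrite mxE.
by case: (du_s i).
Qed.

Lemma is_derive_dot u v s (du dv : 'rV[R]_3) :
  is_derive s 1 u du -> is_derive s 1 v dv ->
  is_derive s 1 (fun t => dot (u t) (v t)) (dot du (v s) + dot (u s) dv).
Proof.
move=> /is_derive_rVP hu /is_derive_rVP hv.
rewrite (_ : (fun t => _) =
  \sum_(i < 3) ((fun t => u t 0 i) * (fun t => v t 0 i))); last first.
  by apply/funext => t; rewrite dotE fct_sumE.
rewrite !dotE -big_split /=; apply: is_derive_sum => i.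
have := is_deriveM (hu i) (hv i).
by rewrite addrC /GRing.scale/= (mulrC (v s 0 i)).
Qed.

Lemma is_derive_scale f u s (df : R) (du : 'rV[R]_3) :
  is_derive s 1 f df -> is_derive s 1 u du ->
  is_derive s 1 (fun t => f t *: u t) (df *: u s + f s *: du).
Proof.
move=> hf /is_derive_rVP hu; apply/is_derive_rVP => i.
rewrite (_ : (fun t => _) = f * (fun t => u t 0 i)); last first.
  by apply/funext => t; rewrite mxE.
apply: is_derive_eq; rewrite !mxE addrC /GRing.scale/=.
by rewrite (mulrC df).
Qed.

(** A point of a nondegenerate interval is a limit of other points of the
    interval, even when it is an endpoint, and difference quotients along these
    already determine a two-sided derivative. *)
Lemma is_derive_eq_on_interval I f g s (df dg : R) :
  nondegenerate_interval I -> I s ->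
  is_derive s 1 f df -> is_derive s 1 g dg ->
  (forall t, I t -> f t = g t) -> df = dg.
Proof.
move=> [Iitv [p [q [Ip Iq pq]]]] Is hf hg fg.
have [r [Ir rs]] : exists r, I r /\ r != s.
  by have [qs|] := eqVneq q s; [exists p; rewrite -qs lt_eqF|exists q].
have [dh hE] := is_deriveB hf hg.
apply/eqP; rewrite -subr_eq0 -normr_eq0 eq_le normr_ge0 andbT.
apply/ler_addgt0Pl => e e0; rewrite addr0; apply/ltW.
have : h^-1 *: (((f - g) \o shift s) h%:A - (f - g) s) @[h --> 0^']
    --> df - dg by rewrite -hE; exact: dh.
move=> /cvgrPdist_lt/(_ e e0)[d /= d0 hd].
have rs0 : 0 < `|r - s| by rewrite normr_gt0 subr_eq0.
(* The step (r - s) * m stays between s and r since m < 1, and is shorter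
   than d since d * `|r - s| < d * (d + `|r - s|). *)
pose m := d / (d + `|r - s|).
have D0 : 0 < d + `|r - s| by rewrite addr_gt0.
have m0 : 0 < m by rewrite divr_gt0.
have m1 : m < 1 by rewrite ltr_pdivrMr// mul1r ltrDl.
have k0 : (r - s) * m != 0 by rewrite mulf_neq0 ?subr_eq0// gt_eqF.
have := hd ((r - s) * m); rewrite /= /shift /= [(_ * _)%:A]mulr1.
have Ik : I ((r - s) * m + s).
  case/orP: (real_leVge (num_real r) (num_real s)) => le_rs.
    by apply: (Iitv r s) => //; apply/andP; split; nra.
  by apply: (Iitv s r) => //; apply/andP; split; nra.
rewrite !fctE (fg _ Ik) (fg _ Is) !subrr scaler0 subr0; apply => //.
rewrite sub0r normrN normrM (gtr0_norm m0) /m mulrA ltr_pdivrMr//.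
nra.
Qed.

Lemma derive_cst_on_interval I f s (df k : R) :
  nondegenerate_interval I -> I s -> is_derive s 1 f df ->
  (forall t, I t -> f t = k) -> df = 0.
Proof.
move=> hI Is hf fk.
exact: (is_derive_eq_on_interval hI Is hf (is_derive_cst k s 1)).
Qed.

Lemma affine_on_interval I f (k : R) :
  nondegenerate_interval I ->
  (forall s, I s -> is_derive s 1 f k) ->
  exists d : R, forall s, I s -> f s = k * s + d.
Proof.
move=> [Iitv [p [_ [Ip _ _]]]] hf; exists (f p - k * p).
have slope a b : a <= b -> I a -> I b -> f b - f a = k * (b - a).
  move=> ab Ia Ib.
  have Iab t : t \in `[a, b] -> I t by rewrite in_itv; exact: Iitv.
  have [||c _ //] := @MVT_segment R f (cst k) a b ab.
    by move=> t /subset_itv_oo_cc/Iab/hf.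
    by apply: derivable_within_continuous => t /Iab/hf[].
move=> s Is; case/orP: (real_leVge (num_real p) (num_real s)) => ps.
  by have := slope _ _ ps Ip Is; lra.
by have := slope _ _ ps Is Ip; lra.
Qed.
End Derivatives.

(** * The Frenet frame *)

Section Frenet.
Variables (R : realType) (I : set R) (x : R -> 'rV[R]_3).
Hypothesis hI : nondegenerate_interval I.
Hypothesis hx : three_times_derivable I x.
Hypothesis hunit : unit_speed I x.
Hypothesis curvature_neq0 : forall s, I s -> curvature x s != 0.

Lemma is_derive_derive1n (k : nat) (s : R) :
  (k < 3)%N -> I s -> is_derive s 1 (derive1n k x) (derive1n k.+1 x s).
Proof.
by move=> k3 Is; rewrite derive1nS derive1E; exact/derivableP/hx.
Qed.

Lemma is_derive_position s : I s -> is_derive s 1 x (tangent x s).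
Proof. exact: (@is_derive_derive1n 0). Qed.

Lemma is_derive_tangent s : I s -> is_derive s 1 (tangent x) (derive1n 2 x s).
Proof. exact: (@is_derive_derive1n 1). Qed.

Lemma dot_tangent s : I s -> dot (tangent x s) (tangent x s) = 1.
Proof. by move=> Is; rewrite -enorm_sqr hunit// expr1n. Qed.

(** [<T, T> = 1] is differentiated along the interval; the products with [N1']
    below come from the orthonormality relations in the same way. *)
Lemma dot_tangent_acceleration s : I s ->
  dot (tangent x s) (derive1n 2 x s) = 0.
Proof.
move=> Is; have hT := is_derive_tangent Is.
have := derive_cst_on_interval hI Is (is_derive_dot hT hT) dot_tangent.
by rewrite dotC; lra.
Qed.

Lemma curvature_sqr s :
  curvature x s ^+ 2 = dot (derive1n 2 x s) (derive1n 2 x s).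
Proof. exact: enorm_sqr. Qed.

Lemma accelerationE s : I s ->
  derive1n 2 x s = curvature x s *: normal1 x s.
Proof. by move=> Is; rewrite scalerA mulfV ?scale1r// curvature_neq0. Qed.

Lemma dot_normal1 s : I s -> dot (normal1 x s) (normal1 x s) = 1.
Proof.
move=> Is; rewrite dotZl dotZr -curvature_sqr expr2 mulKf ?mulVf//;
  exact: curvature_neq0.
Qed.

Lemma dot_tangent_normal1 s : I s -> dot (tangent x s) (normal1 x s) = 0.
Proof. by move=> Is; rewrite dotZr dot_tangent_acceleration// mulr0. Qed.

(** The square root is differentiable away from [0], so nonvanishing curvature is
    what makes the curvature, and with it [N1], differentiable. *)
Lemma is_derive_curvature s : I s ->
  is_derive s 1 (curvature x) (derive1 (curvature x) s).
Proof.
move=> Is; rewrite derive1E; apply: derivableP.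
have h2 := @is_derive_derive1n 2 s isT Is.
have q0 : 0 < dot (derive1n 2 x s) (derive1n 2 x s).
  by rewrite -curvature_sqr exprn_even_gt0//= curvature_neq0.
have [] := @is_derive1_comp _ Num.sqrt _ s _ _
  (is_derive1_sqrt q0) (is_derive_dot h2 h2).
done.
Qed.

Lemma is_derive_normal1 s : I s ->
  is_derive s 1 (normal1 x) (derive1 (normal1 x) s).
Proof.
move=> Is; rewrite derive1E; apply: derivableP.
have h2 := @is_derive_derive1n 2 s isT Is.
have hk := is_deriveV (curvature_neq0 Is) (is_derive_curvature Is).
by have [] := is_derive_scale hk h2.
Qed.

Lemma dot_derive_normal1_tangent s : I s ->
  dot (derive1 (normal1 x) s) (tangent x s) = - curvature x s.
Proof.
move=> Is.
have hd := is_derive_dot (is_derive_tangent Is) (is_derive_normal1 Is).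
have := derive_cst_on_interval hI Is hd dot_tangent_normal1.
rewrite (accelerationE Is) dotZl dot_normal1// mulr1 [X in _ + X]dotC.
by move/eqP; rewrite addrC addr_eq0 => /eqP.
Qed.

Lemma dot_derive_normal1_normal1 s : I s ->
  dot (derive1 (normal1 x) s) (normal1 x s) = 0.
Proof.
move=> Is; have hN := is_derive_normal1 Is.
have := derive_cst_on_interval hI Is (is_derive_dot hN hN) dot_normal1.
by rewrite [X in _ + X]dotC; lra.
Qed.

Lemma frenet_expansion s w : I s ->
  w = dot w (tangent x s) *: tangent x s + dot w (normal1 x s) *: normal1 x s
      + dot w (normal2 x s) *: normal2 x s.
Proof.
by move=> Is; apply: orthonormal_expansion;
  [exact: dot_tangent|exact: dot_normal1|exact: dot_tangent_normal1].
Qed.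

Lemma derive_normal1E s : I s ->
  derive1 (normal1 x) s =
    - curvature x s *: tangent x s + torsion x s *: normal2 x s.
Proof.
move=> Is; rewrite [LHS](frenet_expansion _ Is).
by rewrite dot_derive_normal1_tangent// dot_derive_normal1_normal1// scale0r addr0.
Qed.

(** * Coordinates of the position vector *)

Lemma is_derive_tangential_coord s : I s ->
  is_derive s 1 (fun t => dot (x t) (tangent x t))
    (1 + dot (x s) (derive1n 2 x s)).
Proof.
move=> Is.
have := is_derive_dot (is_derive_position Is) (is_derive_tangent Is).
by rewrite dot_tangent.
Qed.

Lemma is_derive_normal1_coord s : I s ->
  is_derive s 1 (fun t => dot (x t) (normal1 x t))
    (dot (x s) (derive1 (normal1 x) s)).
Proof.
move=> Is.
have := is_derive_dot (is_derive_position Is) (is_derive_normal1 Is).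
by rewrite dot_tangent_normal1// add0r.
Qed.

Lemma enorm_tangential_part_sqr s : I s ->
  enorm (tangential_part x s) ^+ 2 = dot (x s) (tangent x s) ^+ 2.
Proof.
by move=> Is; rewrite enorm_sqr dotZl dotZr dot_tangent// mulr1 expr2.
Qed.

Lemma enorm_normal_part_sqr s : I s -> enorm (normal_part x s) ^+ 2 =
  dot (x s) (x s) - dot (x s) (tangent x s) ^+ 2.
Proof.
move=> Is; rewrite enorm_sqr dotBl ![dot _ (normal_part x s)]dotC !dotBl.
rewrite !dotZl !dotZr dot_tangent// [dot (tangent x s) _]dotC.
ring.
Qed.

(** If [x] were [A T] throughout, then [<x, N1> = 0], whose derivative is
    [<x, N1'> = - k1 A]; hence [A = 0], contradicting [A' = 1 + k1 <x, N1> = 1]. *)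
Lemma normal_part_neq0 : exists2 t, I t & enorm (normal_part x t) != 0.
Proof.
apply: contrapT => allN.
have xE s : I s -> x s = dot (x s) (tangent x s) *: tangent x s.
  move=> Is; apply/eqP; rewrite -subr_eq0; apply/eqP/dot_eq0.
  rewrite -enorm_sqr; apply/eqP; rewrite sqrf_eq0.
  by apply: contrapT => /negP ?; apply: allN; exists s.
have xN s : I s -> dot (x s) (normal1 x s) = 0.
  by move=> Is; rewrite xE// dotZl dot_tangent_normal1// mulr0.
have xT s : I s -> dot (x s) (tangent x s) = 0.
  move=> Is.
  have := derive_cst_on_interval hI Is (is_derive_normal1_coord Is) xN.
  have -> w : dot (x s) w = dot (x s) (tangent x s) * dot w (tangent x s).
    by rewrite {1}(xE s Is) dotZl [dot w _]dotC.
  rewrite (dot_derive_normal1_tangent Is).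
  move/eqP; rewrite mulf_eq0 oppr_eq0 (negbTE (curvature_neq0 Is)) orbF.
  by move/eqP.
have [_ [s [_ [Is _ _]]]] := hI.
have := derive_cst_on_interval hI Is (is_derive_tangential_coord Is) xT.
rewrite accelerationE// dotZr xN// mulr0 addr0 => /eqP.
by rewrite oner_eq0.
Qed.

(** * Constant ratio *)

Hypothesis hcr : constant_ratio I x.

(** The constant is read off at a point [t] where [x] is not tangential, as the
    cosine [|A t| / |x t|], which is then less than [1]. *)
Lemma constant_ratio_tangential_coord :
  exists2 c : R, 0 <= c < 1 & forall s, I s ->
    dot (x s) (tangent x s) ^+ 2 = c ^+ 2 * dot (x s) (x s).
Proof.
have [t It nt0] := normal_part_neq0.
set A := dot (x t) (tangent x t); set g := dot (x t) (x t).
have ntE : enorm (normal_part x t) ^+ 2 = g - A ^+ 2.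
  exact: enorm_normal_part_sqr.
have gA : 0 < g - A ^+ 2 by rewrite -ntE exprn_even_gt0//= nt0.
have g0 : 0 < g by have := sqr_ge0 A; lra.
have c2 : (`|A| / enorm (x t)) ^+ 2 = A ^+ 2 / g.
  by rewrite expr_div_n enorm_sqr real_normK ?num_real.
exists (`|A| / enorm (x t)).
  have c0 : 0 <= `|A| / enorm (x t) by rewrite divr_ge0// sqrtr_ge0.
  rewrite c0 -(@expr_lt1 _ 2)// c2 ltr_pdivrMr// mul1r.
  by lra.
move=> s Is; rewrite c2 mulrAC; apply: (canRL (mulfK (lt0r_neq0 g0))).
(* Squares an equality of products, each square being replaced by its value. *)
have sqr_prod (a b d e a2 b2 d2 e2 : R) : a ^+ 2 = a2 -> b ^+ 2 = b2 ->
    d ^+ 2 = d2 -> e ^+ 2 = e2 -> a * b = d * e -> a2 * b2 = d2 * e2.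
  by move=> <- <- <- <- abde; rewrite -(exprMn 2) abde exprMn.
have := sqr_prod _ _ _ _ _ _ _ _ (enorm_tangential_part_sqr Is) ntE
  (enorm_tangential_part_sqr It) (enorm_normal_part_sqr Is) (hcr Is It).
rewrite -/A => ratio.
by lra.
Qed.

(** The derivative of [<x, T>] is [c ^ 2].  Dividing [A (A' - c ^ 2) = 0] by [A]
    is legitimate because a zero of [A] would be a zero of [x], where one more
    differentiation forces [c = 1]. *)
Lemma derive_tangential_coord c s : 0 <= c < 1 ->
  (forall t, I t ->
    dot (x t) (tangent x t) ^+ 2 = c ^+ 2 * dot (x t) (x t)) ->
  I s -> 1 + dot (x s) (derive1n 2 x s) = c ^+ 2.
Proof.
move=> /andP[c0 c1] hc Is.
have hA t (It : I t) := is_derive_tangential_coord It.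
have [cE|cN0] := eqVneq c 0.
  have A0 t : I t -> dot (x t) (tangent x t) = 0.
    move=> It; apply/eqP; rewrite -sqrf_eq0 hc// cE expr0n mul0r//.
  by rewrite (derive_cst_on_interval hI Is (hA s Is) A0) cE expr0n.
pose A t := dot (x t) (tangent x t).
pose B t := 1 + dot (x t) (derive1n 2 x t).
have AB t : I t -> A t * (B t - c ^+ 2) = 0.
  move=> It.
  have hxt := is_derive_position It.
  have hl := is_deriveM (hA t It) (hA t It).
  have hr := is_deriveZ (c ^+ 2) (is_derive_dot hxt hxt).
  have := is_derive_eq_on_interval hI It hl hr.
  rewrite [dot (tangent x t) _]dotC /GRing.scale/= -/(A t) -/(B t) => sqrAE.
  have : A t * B t + A t * B t = c ^+ 2 * (A t + A t).
    by apply: sqrAE => r Ir; rewrite -[LHS]expr2; exact: hc.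
  by lra.
have [A0|A_neq0] := eqVneq (A s) 0; last first.
  by have /eqP := AB s Is; rewrite mulf_eq0 (negbTE A_neq0)/= subr_eq0 => /eqP.
have x0 : x s = 0.
  apply: dot_eq0; apply/eqP.
  have /eqP := hc s Is; rewrite -/(A s) A0 expr0n eq_sym mulf_eq0 sqrf_eq0.
  by rewrite (negbTE cN0).
have B1 : B s = 1 by rewrite /B x0 /dot mul0mx mxE addr0.
have [dB hB] : exists dB : R, is_derive s 1 (fun t => B t - c ^+ 2) dB.
  have h2 := @is_derive_derive1n 2 s isT Is.
  have hd := is_derive_dot (is_derive_position Is) h2.
  eexists.
  exact: (is_deriveB (is_deriveD (is_derive_cst (1 : R) s 1) hd)
    (is_derive_cst (c ^+ 2) s 1)).
have := derive_cst_on_interval hI Is (is_deriveM (hA s Is) hB) AB.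
rewrite /GRing.scale/= -/(A s) -/(B s) A0 B1 => ?.
by exfalso; nra.
Qed.
End Frenet.

Theorem proposition2 (R : realType) (I : set R) (x : R -> 'rV[R]_3)
    (hI : nondegenerate_interval I)
    (hx : three_times_derivable I x)
    (hunit : unit_speed I x)
    (htw : twisted I x)
    (hcr : constant_ratio I x) :
  exists b c : R, 0 <= c < 1 /\
    forall s : R, I s ->
      x s =
        (c ^+ 2 * s + c * b) *: tangent x s
        + ((c ^+ 2 - 1) / curvature x s) *: normal1 x s
        + (curvature x s * (c ^+ 2 * s + c * b) / torsion x s
           - (c ^+ 2 - 1) * derive1 (curvature x) s
             / (torsion x s * curvature x s ^+ 2)) *: normal2 x s.
Proof.
have hk s : I s -> curvature x s != 0 by move=> /htw[].
have [c c01 hc] := constant_ratio_tangential_coord hI hx hunit hk hcr.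
have hB s : I s -> 1 + dot (x s) (derive1n 2 x s) = c ^+ 2.
  exact: derive_tangential_coord.
have [b xT] : exists b, forall s, I s ->
    dot (x s) (tangent x s) = c ^+ 2 * s + c * b.
  (* The constant term must be a multiple of c: for c = 0 it vanishes because
     <x, T> does. *)
  have [|d hd] := @affine_on_interval R I (fun t => dot (x t) (tangent x t))
    (c ^+ 2) hI.
    move=> s Is; rewrite -(hB s Is).
    exact: (is_derive_tangential_coord hx hunit Is).
  have [cE|c0] := eqVneq c 0; last first.
    by exists (d / c) => s /hd ->; rewrite mulrCA mulfV// mulr1.
  exists 0 => s Is; rewrite mulr0 addr0; apply/eqP.
  by rewrite cE expr0n mul0r -sqrf_eq0 hc// cE expr0n mul0r.
exists b, c; split=> // s Is.
have xN1 t : I t -> dot (x t) (normal1 x t) = (c ^+ 2 - 1) / curvature x t.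
  move=> It; apply: (canRL (mulfK (hk _ It))).
  by rewrite mulrC -dotZr -(accelerationE hk It) -(hB t It) addrAC subrr add0r.
have xN2 : dot (x s) (normal2 x s) =
    curvature x s * (c ^+ 2 * s + c * b) / torsion x s
    - (c ^+ 2 - 1) * derive1 (curvature x) s
      / (torsion x s * curvature x s ^+ 2).
  (* Two expressions of the derivative of <x, N1>, compared and solved for
     <x, N2>. *)
  have hl := is_derive_normal1_coord hI hx hunit hk Is.
  have hr := is_deriveZ (c ^+ 2 - 1)
    (is_deriveV (hk s Is) (is_derive_curvature hx hk Is)).
  have := is_derive_eq_on_interval hI Is hl hr xN1.
  rewrite (derive_normal1E hI hx hunit hk Is) dotDr !dotZr xT//.
  rewrite /GRing.scale/= => E.
  have tau0 : torsion x s != 0 by have [] := htw s Is.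
  have k0 := hk s Is.
  apply: (mulfI tau0).
  have -> : torsion x s * dot (x s) (normal2 x s) =
    curvature x s * (c ^+ 2 * s + c * b) +
    (c ^+ 2 - 1) * (- curvature x s ^- 2 * derive1 (curvature x) s).
    by rewrite -E; ring.
  by field; rewrite k0 tau0.
by rewrite [LHS](frenet_expansion hI hx hunit hk _ Is) xT// xN1// xN2.
Qed.
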